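(* Let $X_1,\dots,X_\ell$ be i.i.d. non-negative random variables, each of which has mean $1$. Then, for all integers $d \geq 1$, $$\Pr[X_1 + \dots + X_\ell \geq \ell + d] \leq g(\ell+d, d).$$
   Context: Here $g$ denotes the function given by the formula $$g(k,d) := 1 - \left(1 - \frac{(k-d)(k-2d-1)}{(k-1)^2}\right)\left(1 - \frac{1}{k}\right)^{k-d}.$$ Thus, taking $k = \ell + d$, $$g(\ell+d,d) = 1 - \left(1 - \frac{\ell(\ell-d-1)}{(\ell+d-1)^2}\right)\left(1-\frac{1}{\ell+d}\right)^{\ell}.$$
   Formalization: The formal theorem assumes d < ℓ; for every 1 ≤ ℓ ≤ d the claim is false, e.g. for ℓ = d = 1, g(2,1) = 0 while X uniform on {0,2} has Pr[X ≥ 2] = 1/2. *)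

(* Defs.v *)
From HB Require Import structures.
From mathcomp Require Export all_boot all_order all_algebra.
From mathcomp Require Export all_classical all_reals all_analysis.

Set Implicit Arguments.
Unset Strict Implicit.
Unset Printing Implicit Defensive.

Import Order.TTheory GRing.Theory Num.Theory.
Import numFieldNormedType.Exports.

Local Open Scope classical_set_scope.
Local Open Scope ring_scope.

(* The differences k - d, k - 2d - 1 and k - 1 are taken in R (k - 2d - 1 may be
   negative); only the exponent uses natural-number subtraction, which agrees
   with the usual one when d <= k. *)
Definition g (R : realType) (k d : nat) : R :=
  1 - (1 - (k%:R - d%:R) * (k%:R - 2 * d%:R - 1) / (k%:R - 1) ^+ 2)
      * (1 - 1 / k%:R) ^+ (k - d)%N.

(* Every subfamily J satisfies the product rule for all choices of Borel sets. *)
Definition mutually_independent (dsp : measure_display)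
    (T : measurableType dsp) (R : realType) (P : probability T R)
    (I : finType) (X : I -> {RV P >-> R}) : Prop :=
  forall (J : {set I}) (A : I -> set R),
    (forall i, measurable (A i)) ->
    P [set t | forall i, i \in J -> A i (X i t)] =
      (\prod_(i in J) P (X i @^-1` A i))%E.

(* Equality of laws is stated set by set: Leibniz equality of the bundled
   measures would also constrain their behaviour on non-measurable sets. *)
Definition identically_distributed (dsp : measure_display)
    (T : measurableType dsp) (R : realType) (P : probability T R)
    (I : Type) (X : I -> {RV P >-> R}) : Prop :=
  forall (i j : I) (A : set R),
    measurable A -> distribution P (X i) A = distribution P (X j) A.

(* Main.v *)
(* Fix [p > 1/k], with [k = l + d], and split the common law [mu] at its upper
   [p]-quantile [c]: [mu = p zeta + (1 - p) ups], where [zeta] lives on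
   [[c, +oo[] and [ups] on []-oo, c]].  Let [Z] have law [zeta], let [S_n] be a sum
   of [n] independent variables of law [ups], and put [S = S_(l-1)].  Keeping only
   the outcomes with at most one summand drawn from [zeta],
     Pr[X_1 + ... + X_l < k] >=
       (1-p)^l Pr[S_l < k] + l p (1-p)^(l-1) Pr[Z + S < k].
   If [S_l >= k], dropping one summand leaves at least [k - c]; Markov's inequality
   and exchangeability give [Pr[S_l >= k] <= (l p / (1-p)) Pr[S >= k - c]].
   With [t = (l-1) p / (1-p) >= 1/2] the mean condition reads
   [t E Z + E S < t k], so some [z] in []0, k[] satisfies
   [Pr[S >= k - z] < t w] with [w = Pr[Z <= z]].  Necessarily [z >= c], whence
     Pr[S >= k - c] - Pr[Z + S < k] <= t w - w (1 - t w) <= 2 t - 1,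
   the last step by convexity in [w].  Together these bounds give the claim with [p]
   in place of [1/k], and one lets [p] decrease to [1/k]; the strict inequality
   [p k > 1] is needed because the choice of [z] can fail at [p = 1/k]. *)

Require Import Defs.
From HB Require Import structures.
From mathcomp Require Import all_boot all_order all_algebra.
From mathcomp Require Import all_classical all_reals all_analysis.
From mathcomp Require Import measurable_realfun ring lra.

Set Implicit Arguments.
Unset Strict Implicit.
Unset Printing Implicit Defensive.

Import Order.TTheory GRing.Theory Num.Theory.
Import numFieldNormedType.Exports.

Local Open Scope classical_set_scope.
Local Open Scope ring_scope.

(** * Convolution of probability laws on the line *)

Section convolution.
Context {R : realType}.
Local Open Scope ereal_scope.
Implicit Types (m : probability R R) (f : R -> \bar R).

Definition pair_sum (z : R * R) :
  R := (z.1 + z.2)%R.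

Lemma measurable_pair_sum : measurable_fun setT pair_sum.
Proof. exact: measurable_funD. Qed.

HB.instance Definition _ := isMeasurableFun.Build _ _ _ _ pair_sum
  measurable_pair_sum.

Definition conv m1 m2 : probability R R :=
  distribution (m1 \x m2)%E pair_sum.

Fixpoint convn m n : probability R R :=
  if n is n'.+1 then conv m (convn m n') else dirac (0%R : R).

Lemma measurable_shift f (x : R) :
  measurable_fun [set: R] f ->
  measurable_fun [set: R] (fun y : R => f (x + y)%R).
Proof. by move=> mf; apply: measurableT_comp => //; exact: measurable_funD. Qed.

Lemma measurable_integral_shift m f :
  measurable_fun [set: R] f -> (forall x, 0 <= f x) ->
  measurable_fun [set: R]
    (fun x : R => \int[m]_y f (x + y)%R).
Proof.
move=> mf f0.
apply: (measurable_fun_fubini_tonelli_F (m2 := m)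
  (fun z : R * R => f (z.1 + z.2)%R)) => //.
by apply: measurableT_comp => //; exact: measurable_pair_sum.
Qed.

Lemma integral_conv m1 m2 f :
  measurable_fun [set: R] f -> (forall x, 0 <= f x) ->
  \int[conv m1 m2]_x f x = \int[m1]_x \int[m2]_y f (x + y)%R.
Proof.
move=> mf f0; rewrite ge0_integral_distribution//.
apply: (fubini_tonelli1 (m1 := m1) (m2 := m2) (f \o pair_sum)).
  by apply: measurableT_comp => //; exact: measurable_pair_sum.
by move=> z; exact: f0.
Qed.

(** Tonelli exchanges the two outer integrals. It serves to move a [zeta] factor past an [ups]
    factor under an integral. *)
Lemma integral_convCA m1 m2 m3 f :
  measurable_fun [set: R] f -> (forall x, 0 <= f x) ->
  \int[conv m1 (conv m2 m3)]_x f x = \int[conv m2 (conv m1 m3)]_x f x.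
Proof.
move=> mf f0; rewrite 2!(integral_conv _ _ mf f0).
transitivity (\int[m1]_x \int[m2]_y \int[m3]_z f (x + y + z)%R).
  apply: eq_integral => x _; rewrite (integral_conv _ _ (measurable_shift x mf) (fun y => f0 _)).
  by apply: eq_integral => y _; apply: eq_integral => z _; rewrite addrA.
rewrite (fubini_tonelli (m1 := m1) (m2 := m2)
  (fun z : R * R =>
     \int[m3]_t f (z.1 + z.2 + t)%R))//; last 2 first.
- apply: (measurableT_comp (measurable_integral_shift m3 mf f0)).
  exact: measurable_pair_sum.
- by move=> z; exact: integral_ge0.
apply: eq_integral => x _; rewrite (integral_conv _ _ (measurable_shift x mf) (fun y => f0 _)).
by apply: eq_integral => y _; apply: eq_integral => z _; rewrite addrA (addrC x).
Qed.

End convolution.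

(** * Integration against a mixture of two laws *)

Section mixture_integral.
Context d (T : measurableType d) {R : realType}.
Local Open Scope ereal_scope.
Implicit Types (mu zeta ups : probability T R) (f : T -> \bar R).

(** The identity is required on measurable sets only, which is all that integrals depend on. *)
Definition mixture (p : R) zeta ups mu := forall A : set T, measurable A ->
  mu A = p%:E * zeta A + (1 - p)%:E * ups A.

Lemma integral_mixture (p : R) zeta ups mu f : (0 <= p <= 1)%R ->
  mixture p zeta ups mu ->
  measurable_fun [set: T] f -> (forall x, 0 <= f x) ->
  \int[mu]_x f x = p%:E * \int[zeta]_x f x + (1 - p)%:E * \int[ups]_x f x.
Proof.
move=> /andP[p0 p1] mix mf f0.
have q0 : (0 <= 1 - p)%R by rewrite subr_ge0.
pose mz : {measure set T -> \bar R} := mscale (NngNum p0) zeta.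
pose mu' : {measure set T -> \bar R} := mscale (NngNum q0) ups.
transitivity (\int[measure_add mz mu']_x f x).
  apply: eq_measure_integral => A mA _.
  exact: etrans (mix A mA) (esym (measure_addE mz mu' A)).
transitivity (\int[mz]_x f x + \int[mu']_x f x).
  exact: ge0_integral_measure_add.
by congr (_ + _); exact: ge0_integral_mscale.
Qed.

End mixture_integral.

(** * Convolution powers of a mixture *)

Section mixture.
Context {R : realType}.
Local Open Scope ereal_scope.
Implicit Types (mu zeta ups : probability R R) (f : R -> \bar R).

(* Expand the n-th convolution power of [p zeta + (1 - p) ups] and keep only the
   terms with at most one factor [zeta]. *)
Lemma convn_mixture_ge (p : R) zeta ups mu n f : (0 <= p <= 1)%R ->
  mixture p zeta ups mu ->
  measurable_fun [set: R] f -> (forall x, 0 <= f x) ->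
  ((1 - p) ^+ n.+1)%:E * \int[convn ups n.+1]_x f x +
  (n.+1%:R * p * (1 - p) ^+ n)%:E * \int[conv zeta (convn ups n)]_x f x <=
  \int[convn mu n.+1]_x f x.
Proof.
move=> p01 mix; have /andP[p0 p1] := p01.
have q0 : (0 <= 1 - p)%R by rewrite subr_ge0.
have c0 k : 0 <= ((1 - p) ^+ k)%:E :> \bar R by rewrite lee_fin exprn_ge0.
have d0 k : 0 <= (k.+1%:R * p * (1 - p) ^+ k)%:E :> \bar R.
  by rewrite lee_fin !mulr_ge0// exprn_ge0.
elim: n f => [|n IH] f mf f0.
  rewrite [leRHS]integral_conv// (integral_mixture p01 mix)//; last 2 first.
  - exact: measurable_integral_shift.
  - by move=> x; exact: integral_ge0.
  by rewrite expr1 expr0 mul1r mulr1 -!integral_conv// addeC.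
rewrite [leRHS]integral_conv// (integral_mixture p01 mix)//; last 2 first.
- exact: measurable_integral_shift.
- by move=> x; exact: integral_ge0.
set Phi := fun x : R => \int[convn mu n.+1]_y f (x + y)%R.
pose A (x : R) := \int[convn ups n.+1]_y f (x + y)%R.
pose B (x : R) := \int[conv zeta (convn ups n)]_y f (x + y)%R.
have A0 x : 0 <= A x by apply: integral_ge0.
have B0 x : 0 <= B x by apply: integral_ge0.
have mPhi : measurable_fun [set: R] Phi by exact: measurable_integral_shift.
have mA : measurable_fun [set: R] A by exact: measurable_integral_shift.
have mB : measurable_fun [set: R] B by exact: measurable_integral_shift.
have AB x : ((1 - p) ^+ n.+1)%:E * A x +
    (n.+1%:R * p * (1 - p) ^+ n)%:E * B x <= Phi x.
  by apply: IH => //; exact: measurable_shift.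
(* First summand from [zeta]: only the outcomes with no further [zeta] are kept. *)
have Z : ((1 - p) ^+ n.+1)%:E * \int[zeta]_x A x <= \int[zeta]_x Phi x.
  rewrite -ge0_integralZl_EFin//; last by rewrite exprn_ge0.
  apply: ge0_le_integral => //.
  - by move=> x _; rewrite mule_ge0.
  - exact: measurable_funeM.
  by move=> x _; apply: le_trans (AB x); rewrite leeDl// mule_ge0.
(* First summand from [ups]: at most one of the others comes from [zeta]. *)
have U : ((1 - p) ^+ n.+1)%:E * \int[ups]_x A x +
    (n.+1%:R * p * (1 - p) ^+ n)%:E * \int[ups]_x B x <= \int[ups]_x Phi x.
  rewrite -!ge0_integralZl_EFin//; last 2 first.
  - by rewrite !mulr_ge0// exprn_ge0.
  - by rewrite exprn_ge0.
  rewrite -ge0_integralD//; last 4 first.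
  - by move=> x _; rewrite mule_ge0.
  - exact: measurable_funeM.
  - by move=> x _; rewrite mule_ge0.
  - exact: measurable_funeM.
  apply: ge0_le_integral => //.
  - by move=> x _; rewrite adde_ge0// mule_ge0.
  - by apply: emeasurable_funD; exact: measurable_funeM.
have iA : \int[conv ups (convn ups n.+1)]_x f x = \int[ups]_x A x.
  by rewrite (integral_conv _ _ mf f0).
have iZ : \int[conv zeta (convn ups n.+1)]_x f x = \int[zeta]_x A x.
  by rewrite (integral_conv _ _ mf f0).
have iB : \int[conv zeta (convn ups n.+1)]_x f x = \int[ups]_x B x.
  apply: etrans (integral_convCA zeta ups (convn ups n) mf f0) _.
  exact: (integral_conv ups (conv zeta (convn ups n)) mf f0).
rewrite [X in _ * X + _]iA.
apply: (@le_trans _ _ (p%:E * (((1 - p) ^+ n.+1)%:E * \int[zeta]_x A x) +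
  (1 - p)%:E * (((1 - p) ^+ n.+1)%:E * \int[ups]_x A x +
    (n.+1%:R * p * (1 - p) ^+ n)%:E * \int[ups]_x B x))); last first.
  by apply: leeD; apply: lee_wpmul2l => //; rewrite lee_fin.
rewrite -iZ -iB.
set S := \int[conv zeta (convn ups n.+1)]_x f x; set V := \int[ups]_x A x.
have S0 : 0 <= S by exact: integral_ge0.
have V0 : 0 <= V by exact: integral_ge0.
rewrite (ge0_muleDr _ (mule_ge0 (c0 n.+1) V0) (mule_ge0 (d0 n) S0)) !muleA -!EFinM addeCA -exprS leeD2l//.
(* The terms with exactly one [zeta] add up: [p (1-p)^(n+1) + (1-p) (n+1) p (1-p)^n = (n+2) p
   (1-p)^(n+1)]. *)
rewrite -ge0_muleDl; last 2 first.
- by rewrite lee_fin mulr_ge0// exprn_ge0.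
- by rewrite lee_fin !mulr_ge0// exprn_ge0.
rewrite -EFinD lee_wpmul2r// lee_fin le_eqVlt; apply/orP; left; apply/eqP.
by rewrite [in RHS]exprS -[in RHS]natr1 -[in LHS]natr1 exprS -natr1; ring.
Qed.

End mixture.

(** * Exchangeability and positive parts *)

Section convn_first_moment.
Context {R : realType}.
Local Open Scope ereal_scope.
Implicit Types (m : probability R R) (h : R -> \bar R).

(** The positive part of a sum is at most the sum of the positive parts, and by exchangeability all
    [n.+1] summands contribute equally. Taking [h = 1] bounds a mean; taking an indicator prepares
    Markov's inequality. Positive parts stand in for nonnegativity of the summands. *)
Lemma integral_convn_pos m n h :
  measurable_fun [set: R] h -> (forall x, 0 <= h x) ->
  \int[convn m n.+1]_x ((Num.max x 0)%:E * h x) <=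
  n.+1%:R%:E * \int[m]_x ((Num.max x 0)%:E * \int[convn m n]_y h (x + y)%R).
Proof.
have pos0 (x : R) : 0 <= (Num.max x 0)%:E by rewrite lee_fin le_max lexx orbT.
have mpos : measurable_fun [set: R] (fun x : R => (Num.max x 0)%:E).
  by apply/measurable_EFinP; exact: measurable_maxr.
have mposh g : measurable_fun [set: R] g ->
    measurable_fun [set: R] (fun x => (Num.max x 0)%:E * g x).
  by move=> mg; exact: emeasurable_funM.
have split_first m2 g : measurable_fun [set: R] g -> (forall x, 0 <= g x) ->
    \int[conv m m2]_x ((Num.max x 0)%:E * g x) <=
    \int[m]_x ((Num.max x 0)%:E * \int[m2]_y g (x + y)%R) +
    \int[m]_x \int[m2]_y ((Num.max y 0)%:E * g (x + y)%R).
  move=> mg g0.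
  have mG : measurable_fun [set: R * R]
      (fun z : R * R => (Num.max z.2 0)%:E * g (z.1 + z.2)%R).
    apply: emeasurable_funM; first exact: (measurableT_comp mpos).
    by apply: measurableT_comp => //; exact: measurable_pair_sum.
  have mI2 : measurable_fun [set: R]
      (fun x : R => \int[m2]_y ((Num.max y 0)%:E * g (x + y)%R)).
    apply: (measurable_fun_fubini_tonelli_F (m2 := m2) _ mG).
    by move=> z; rewrite mule_ge0.
  rewrite integral_conv//; last 2 first.
  - exact: mposh.
  - by move=> x; rewrite mule_ge0.
  rewrite -ge0_integralD//; last 3 first.
  - by move=> x _; rewrite mule_ge0// integral_ge0.
  - by apply: mposh; exact: measurable_integral_shift.
  - by move=> x _; apply: integral_ge0 => y _; rewrite mule_ge0.
  apply: ge0_le_integral => //.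
  - by move=> x _; apply: integral_ge0 => y _; rewrite mule_ge0.
  - apply: (measurable_integral_shift m2 (mposh _ mg)) => x.
    by rewrite mule_ge0.
  - apply: emeasurable_funD => //.
    by apply: mposh; exact: measurable_integral_shift.
  move=> x _.
  have mgx : measurable_fun [set: R] (fun y => g (x + y)%R).
    exact: measurable_shift.
  rewrite -ge0_integralZl_EFin//; last by rewrite le_max lexx orbT.
  rewrite -ge0_integralD//; last 4 first.
  - by move=> y _; rewrite mule_ge0.
  - exact: measurable_funeM.
  - by move=> y _; rewrite mule_ge0.
  - exact: mposh.
  apply: ge0_le_integral => //.
  - by move=> y _; rewrite mule_ge0.
  - exact: (measurable_shift _ (mposh _ mg)).
  - by apply: emeasurable_funD; [exact: measurable_funeM|exact: mposh].
  move=> y _; rewrite -ge0_muleDl// lee_wpmul2r// -EFinD lee_fin.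
  by rewrite ge_max lerD ?le_max ?lexx//= addr_ge0// le_max lexx orbT.
elim: n h => [|n IH] h mh h0.
  apply: (le_trans (split_first _ _ mh h0)).
  rewrite [X in _ + X]integral0_eq ?adde0 ?mul1e// => x _.
  rewrite integral_dirac//; first by rewrite diracT mul1e maxxx mul0e.
  by apply: mposh; exact: measurable_shift.
apply: (le_trans (split_first _ _ mh h0)).
set I := \int[m]_x (_ * _).
(* The first summand contributes [I]; the others are handled by the induction hypothesis for the
   translates of [h]. *)
suff J : \int[m]_x \int[convn m n.+1]_y ((Num.max y 0)%:E * h (x + y)%R) <=
    n.+1%:R%:E * I.
  apply: (le_trans (leeD (lexx I) J)).
  have I0 : 0 <= I by apply: integral_ge0 => x _; rewrite mule_ge0// integral_ge0.
  by rewrite -[X in X + _]mul1e -ge0_muleDl// -EFinD [in leRHS]mulrSr addrC.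
pose H (x y : R) := \int[convn m n]_z h (x + y + z)%R.
have H0 x y : 0 <= H x y by apply: integral_ge0.
have mH : measurable_fun [set: R * R] (fun z : R * R => H z.1 z.2).
  apply: (measurableT_comp (measurable_integral_shift (convn m n) mh h0)).
  exact: measurable_pair_sum.
have mpH : measurable_fun [set: R * R]
    (fun z : R * R => (Num.max z.2 0)%:E * H z.1 z.2).
  by apply: emeasurable_funM => //; exact: (measurableT_comp mpos).
have pH0 (z : R * R) : 0 <= (Num.max z.2 0)%:E * H z.1 z.2 by rewrite mule_ge0.
have mpHF := measurable_fun_fubini_tonelli_F (m2 := m) _ mpH pH0.
(* A second summand [x] is split off while the weight sits on [y]; exchanging the two integrals
   gives the form that the induction hypothesis produces at fixed [x]. *)
rewrite (_ : I = \int[m]_y \int[m]_x ((Num.max y 0)%:E * H x y)); last first.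
  apply: eq_integral => y _.
  rewrite ge0_integralZl_EFin//; last 2 first.
  - exact: (measurable_fun_pair1 y mH).
  - by rewrite le_max lexx orbT.
  congr (_ * _).
  apply: etrans (integral_conv m (convn m n) (measurable_shift y mh) (fun z => h0 _)) _.
  apply: eq_integral => x _; apply: eq_integral => z _.
  by rewrite addrA (addrC y).
rewrite -(fubini_tonelli (m1 := m) (m2 := m) _ mpH pH0).
rewrite -ge0_integralZl_EFin//; last by move=> x _; apply: integral_ge0.
apply: ge0_le_integral => //.
- by move=> x _; apply: integral_ge0 => y _; rewrite mule_ge0.
- apply: (measurable_fun_fubini_tonelli_F (m2 := convn m n.+1)
    (fun z : R * R => (Num.max z.2 0)%:E * h (z.1 + z.2)%R)).
    apply: emeasurable_funM; first exact: (measurableT_comp mpos).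
    by apply: measurableT_comp => //; exact: measurable_pair_sum.
  by move=> z; rewrite mule_ge0.
- exact: measurable_funeM.
move=> x _; apply: (le_trans (IH _ (measurable_shift x mh) (fun z => h0 _))).
rewrite lee_wpmul2l// le_eqVlt; apply/orP; left; apply/eqP.
apply: eq_integral => y _; congr (_ * _); apply: eq_integral => z _.
by rewrite addrA.
Qed.

End convn_first_moment.

(** * Splitting a law at a quantile *)

Section quantile.
Local Open Scope ereal_scope.

(** Restrict [mu] to [D], put the missing mass [r - mu D] as an atom at [c], and divide by [r]. *)
Lemma restricted_probability d (T : measurableType d) (R : realType)
    (mu : probability T R) (D : set T) (c : T) (r : R) :
  measurable D -> (0 < r)%R -> mu D <= r%:E ->
  exists zeta : probability T R, forall A, measurable A ->
    r%:E * zeta A = mu (A `&` D) + (r - fine (mu D))%:E * \d_c A.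
Proof.
move=> mD r0 Dr.
have finD : mu D \is a fin_num by rewrite fin_num_measure.
have s0 : (0 <= r - fine (mu D))%R.
  by rewrite subr_ge0 -lee_fin fineK.
pose m1 : {measure set T -> \bar R} := mrestr mu mD.
pose m2 : {measure set T -> \bar R} := mscale (NngNum s0) (dirac c).
pose m : {measure set T -> \bar R} := measure_add m1 m2.
have mE A : m A = mu (A `&` D) + (r - fine (mu D))%:E * \d_c A.
  exact: (measure_addE m1 m2 A).
have mT : m setT = r%:E.
  by rewrite mE setTI diracT mule1 -[X in X + _](fineK finD) -EFinD addrC subrK.
(* The second argument of [mnormalize] is a default for total mass zero or infinity; here the total
   mass is [r > 0]. *)
exists (mnormalize m (dirac c)) => A mA.
have zE : mnormalize m (dirac c) A = m A * (r^-1)%:E.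
  by rewrite /mnormalize mT /= eqe gt_eqF.
apply: etrans (congr1 (fun x => r%:E * x) zE) _.
by rewrite -mE muleC -muleA -EFinM mulVf ?gt_eqF// mule1.
Qed.

(** A possible atom of [mu] at [c] is shared: each law receives what it lacks to reach total mass
    [p], respectively [1 - p]. *)
Lemma mixture_split (R : realType) (mu : probability R R) (c p : R) :
  (0 < p < 1)%R -> mu `]c, +oo[%classic <= p%:E ->
  mu `]-oo, c[%classic <= (1 - p)%:E ->
  exists zeta ups : probability R R,
    [/\ mixture p zeta ups mu, zeta `]-oo, c[%classic = 0 &
        ups `]c, +oo[%classic = 0].
Proof.
move=> /andP[p0 p1] hi lo.
have q0 : (0 < 1 - p)%R by rewrite subr_gt0.
have [zeta zE] := restricted_probability c (measurable_itv `]c, +oo[) p0 hi.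
have [ups uE] := restricted_probability c (measurable_itv `]-oo, c[) q0 lo.
pose hs : set R := `]c, +oo[%classic; pose ls : set R := `]-oo, c[%classic.
have mhs : measurable hs by exact: measurable_itv.
have mls : measurable ls by exact: measurable_itv.
have fm A : measurable A -> mu A = (fine (mu A))%:E.
  by move=> mA; rewrite fineK// fin_num_measure.
have part A : measurable A ->
    mu A = mu (A `&` hs) + mu (A `&` ls) + mu [set c] * \d_c A.
  move=> mA.
  have mAh : measurable (A `&` hs) by exact: measurableI.
  have mAl : measurable (A `&` ls) by exact: measurableI.
  have mAc : measurable (A `&` [set c]) by exact: measurableI.
  have {1}-> : A = ((A `&` hs) `|` (A `&` ls)) `|` (A `&` [set c]).
    rewrite -!setIUr; apply/esym/setIidl => x _ /=; rewrite /hs /ls /= !in_itv/= andbT.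
    by case: (ltgtP c x) => [| |->]; [left; left|left; right|right].
  rewrite measureU//; last 2 first.
  - exact: measurableU.
  - rewrite -setIUr setIACA setIid; apply/seteqP; split => // x [_ /=].
    rewrite /hs /ls /= !in_itv/= andbT => -[+ xc].
    by rewrite xc ltxx => -[].
  rewrite measureU//; last first.
    rewrite setIACA setIid; apply/seteqP; split => // x [_ /=].
    by rewrite /hs /ls /= !in_itv/= andbT => -[/lt_trans h /h]; rewrite ltxx.
  congr (_ + _); rewrite diracE; have [/[!inE] cA|cA] := boolP (c \in A).
    by rewrite setIidr ?mule1// => x /= ->.
  suff -> : A `&` [set c] = set0 by rewrite measure0 mule0.
    apply/seteqP; split => // x [+ /= xc]; rewrite xc => cA'.
    by move/negP: cA; apply; rewrite inE.
exists zeta, ups; split.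
- move=> A mA; apply: esym; apply: etrans (congr2 _ (zE _ mA) (uE _ mA)) _.
  apply: etrans _ (esym (part A mA)).
  (* On the whole line [part] expresses that the total mass is one, so the two atoms at [c] add up
     to the mass of [c] under [mu]. *)
  have := part _ measurableT; rewrite !setTI probability_setT diracT mule1.
  rewrite -/hs -/ls (fm _ mhs) (fm _ mls) (fm _ (measurable_set1 c)).
  rewrite (fm _ (measurableI _ _ mA mhs)) (fm _ (measurableI _ _ mA mls)) diracE.
  rewrite -!EFinM -!EFinD => -[h1]. congr EFin.
  by rewrite h1; ring.
- have := zE _ (measurable_itv `]-oo, c[).
  have -> : `]-oo, c[%classic `&` `]c, +oo[%classic = set0 :> set R.
    apply/seteqP; split => // x [] /=; rewrite !in_itv/= andbT.
    by move=> /lt_trans h /h; rewrite ltxx.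
  rewrite measure0 diracE memNset ?mule0 ?adde0; last by rewrite /= in_itv/= ltxx.
  by move/eqP; rewrite mule_eq0 eqe gt_eqF//= => /eqP.
- have := uE _ (measurable_itv `]c, +oo[).
  have -> : `]c, +oo[%classic `&` `]-oo, c[%classic = set0 :> set R.
    apply/seteqP; split => // x [] /=; rewrite !in_itv/= andbT.
    by move=> /lt_trans h /h; rewrite ltxx.
  rewrite measure0 diracE memNset ?mule0 ?adde0; last by rewrite /= in_itv/= ltxx.
  by move/eqP; rewrite mule_eq0 eqe gt_eqF//= => /eqP.
Qed.

Section rv.
Context d (T : measurableType d) (R : realType) (P : probability T R).
Variable X : {RV P >-> R}.
Local Notation mu := (distribution P X).

(** Take for [c] the infimum of the [x] with [Pr[X > x] <= p]. Right continuity of the tail gives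
    the first bound, continuity of the measure from below the second. *)
Lemma quantile_exists (p : R) : (0 < p < 1)%R ->
  exists c : R, mu `]c, +oo[ <= p%:E /\ mu `]-oo, c[ <= (1 - p)%:E.
Proof.
move=> /andP[p0 p1].
pose S := [set x : R | ccdf X x <= p%:E].
have Sup x y : S x -> (x <= y)%R -> S y.
  by move=> Sx xy; apply: le_trans Sx; exact: ccdf_nonincreasing.
have S_nonempty : S !=set0.
  apply/set0P/negP => /eqP S0.
  have : p%:E <= 0.
    apply: cvge_ge (cvg_ccdfy0 X); apply: nearW => x.
    by apply/ltW; rewrite ltNge; apply/negP => xp; have : S x by []; rewrite S0.
  by rewrite lee_fin leNgt p0.
have S_lbound : has_lbound S.
  apply: contrapT => noS.
  have : 1 <= p%:E.
    apply: cvge_le (cvg_ccdfNy1 X); apply: nearW => x.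
    apply: contrapT => Sx; apply: noS; exists x => y Sy.
    by rewrite leNgt; apply/negP => /ltW yx; exact/Sx/(Sup y).
  by rewrite lee_fin leNgt p1.
exists (inf S); split.
- apply: (cvge_le _ (@ccdf_right_continuous _ _ _ _ X (inf S))).
  near=> x; have : (inf S < x)%R by near: x; exact: nbhs_right_gt.
  rewrite -subr_gt0 => /inf_adherent/(_ (conj S_nonempty S_lbound))[y Sy].
  by rewrite addrC subrK => /ltW; exact: Sup.
- pose F n : set R := `]-oo, (inf S - n.+1%:R^-1)%R]%classic.
  have FE : `]-oo, inf S[%classic = \bigcup_n F n.
    apply/seteqP; split => [x|x [n _]]; rewrite /F /= !in_itv/=; last first.
      by move=> /le_lt_trans; apply; rewrite gtrBl invr_gt0.
    move=> xS; exists (Num.truncn (inf S - x)^-1) => //=.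
    rewrite in_itv/= lerBrDl addrC -lerBrDl -[leRHS]invrK.
    by rewrite lef_pV2 ?posrE ?ltr0n// ?invr_gt0 ?subr_gt0// ltW// truncnS_gt.
  rewrite FE; have mF n : measurable (F n) by exact: measurable_itv.
  apply: (cvge_le _ (nondecreasing_cvg_mu (mu := mu) mF
    (bigcup_measurable (fun n _ => mF n)) _)).
    apply: nearW => n /=; have := ccdf_cdf_1 X (inf S - n.+1%:R^-1)%R.
    have fc := fin_num_measure mu _ (measurable_itv `](inf S - n.+1%:R^-1)%R, +oo[).
    have fd := fin_num_measure mu _ (mF n).
    (* Strictly left of the infimum the tail exceeds [p], so [F n] has mass below [1 - p]. *)
    have : p%:E < ccdf X (inf S - n.+1%:R^-1)%R.
      rewrite ltNge; apply/negP => Sx.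
      have /(_ _ Sx) := ge_inf S_lbound.
      by rewrite leNgt gtrBl invr_gt0 ltr0Sn.
    rewrite /ccdf /cdf -/(F n) -(fineK fc) -(fineK fd) -EFinD !lte_fin.
    by move=> + [] h; rewrite lee_fin; lra.
  move=> m n mn; apply/subsetPset => x; rewrite /F /= !in_itv/=.
  by move/le_trans; apply; rewrite lerD2l lerN2 lef_pV2 ?posrE ?ltr0n// ler_nat.
Unshelve. all: by end_near.
Qed.

End rv.
End quantile.

(** * Choice of the level [z] *)

Section threshold.
Local Open Scope ereal_scope.

Lemma integral_sections d1 d2 (T1 : measurableType d1) (T2 : measurableType d2)
    (R : realType) (m1 : {sigma_finite_measure set T1 -> \bar R})
    (m2 : {sigma_finite_measure set T2 -> \bar R}) (A : set (T1 * T2)) :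
  measurable A ->
  \int[m1]_x m2 (xsection A x) = \int[m2]_y m1 (ysection A y).
Proof.
move=> mA; have := @indic_fubini_tonelli _ _ _ _ _ m1 m2 A mA.
by rewrite indic_fubini_tonelli_FE// indic_fubini_tonelli_GE.
Qed.

Context {R : realType}.
Implicit Types (zeta sigma : probability R R) (k t : R).

(* Layer cake: if the inequality failed for every [z], integrating it over
   [0 < z < k] would give [t * E (k - Z)^+ <= E S^+]. *)
Lemma threshold_exists zeta sigma k t : (0 < k)%R -> (0 < t)%R ->
  t%:E * \int[zeta]_x (Num.max x 0)%:E + \int[sigma]_x (Num.max x 0)%:E
    < (t * k)%:E ->
  exists z : R, [/\ (0 < z)%R, (z < k)%R &
    sigma `[(k - z)%R, +oo[%classic < t%:E * zeta `]-oo, z]%classic].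
Proof.
move=> k0 t0 lt_tk; apply: contrapT => noz.
pose GR := measurableTypeR R.
pose leb : {sigma_finite_measure set GR -> \bar R} := @lebesgue_measure R.
(* The first coordinate is a random value, the second a level [z] in []0, k[]. Sections at a value
   [x] have length at least [k - x^+], respectively at most [x^+] (positive part); sections at a
   level give the two probabilities to be compared. *)
pose B1 := [set u : R * GR | [&& (0 < u.2)%R, (u.2 < k)%R & (u.1 <= u.2)%R]].
pose B2 := [set u : R * GR | [&& (0 < u.2)%R, (u.2 < k)%R & (k - u.2 <= u.1)%R]].
have m2 : measurable_fun [set: R * GR] (fun u : R * GR => u.2 : R).
  exact: measurable_snd.
have mset (b : R * GR -> bool) : measurable_fun setT b -> measurable [set u | b u].
  by move=> mb; have := mb measurableT [set true]; rewrite setTI; exact.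
have mB1 : measurable B1.
  apply: mset; apply: measurable_and; first exact: measurable_fun_ltr.
  by apply: measurable_and; [exact: measurable_fun_ltr|exact: measurable_fun_ler].
have mB2 : measurable B2.
  apply: mset; apply: measurable_and; first exact: measurable_fun_ltr.
  apply: measurable_and; first exact: measurable_fun_ltr.
  by apply: measurable_fun_ler => //; exact: measurable_funB.
have pos0 (x : R) : 0 <= (Num.max x 0)%:E by rewrite lee_fin le_max lexx orbT.
have mpos : measurable_fun [set: R] (fun x : R => (Num.max x 0)%:E).
  by apply/measurable_EFinP; exact: measurable_maxr.
have le1 x : k%:E <= leb (xsection B1 x) + (Num.max x 0)%:E.
  have [kx|xk] := leP k (Num.max x 0)%R.
    by rewrite (@le_trans _ _ (Num.max x 0)%:E) ?lee_fin// leeDr.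
  have sub : `](Num.max x 0)%R, k[%classic `<=` xsection B1 x.
    move=> y; rewrite /xsection /= in_itv/= gt_max => /andP[/andP[xy y0] yk].
    by rewrite inE /B1/= y0 yk ltW.
  have : leb `](Num.max x 0)%R, k[%classic <= leb (xsection B1 x).
    apply: le_measure => //; rewrite inE; first exact: measurable_itv.
    exact: measurable_xsection.
  rewrite /leb /= lebesgue_measure_itv/= lte_fin xk => /(leeD2r (Num.max x 0)%:E).
  by apply: le_trans; rewrite -EFinB -EFinD subrK.
have le2 x : leb (xsection B2 x) <= (Num.max x 0)%:E.
  have sub : xsection B2 x `<=` `[(k - Num.max x 0)%R, k[%classic.
    move=> y; rewrite /xsection /= inE /B2/= in_itv/= => /and3P[y0 yk xy].
    by rewrite yk andbT lerBlDl -lerBlDr le_max xy.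
  have : leb (xsection B2 x) <= leb `[(k - Num.max x 0)%R, k[%classic.
    apply: le_measure => //; rewrite inE; last exact: measurable_itv.
    exact: measurable_xsection.
  move=> /le_trans; apply; rewrite /leb /= lebesgue_measure_itv/=.
  case: ifPn => [_|//]; by rewrite -EFinB opprB addrC subrK.
(* For [0 < z < k] this negates the desired inequality; otherwise the section of [B1] is empty. *)
have le12 z : t%:E * zeta (ysection B1 z) <= sigma (ysection B2 z).
  have [/andP[z0 zk]|zout] := boolP ((0 < z)%R && (z < k)%R); last first.
    rewrite (_ : ysection B1 z = set0) ?measure0 ?mule0//.
    apply/seteqP; split => // x; rewrite /ysection /= inE /B1/= andbA.
    by rewrite (negbTE zout).
  have -> : ysection B1 z = `]-oo, z]%classic.
    by apply/seteqP; split => x; rewrite /ysection /= inE /B1/= z0 zk in_itv.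
  have -> : ysection B2 z = `[(k - z)%R, +oo[%classic.
    by apply/seteqP; split => x; rewrite /ysection /= inE /B2/= z0 zk in_itv/= andbT.
  by rewrite leNgt; apply/negP => h; apply: noz; exists z; split.
have mx1 : measurable_fun [set: R] (fun x => leb (xsection B1 x)).
  exact: measurable_fun_xsection.
have mx2 : measurable_fun [set: R] (fun x => leb (xsection B2 x)).
  exact: measurable_fun_xsection.
have my1 : measurable_fun [set: GR] (fun x => zeta (ysection B1 x)).
  exact: measurable_fun_ysection.
have my2 : measurable_fun [set: GR] (fun x => sigma (ysection B2 x)).
  exact: measurable_fun_ysection.
have I1 : k%:E <= \int[zeta]_x leb (xsection B1 x) + \int[zeta]_x (Num.max x 0)%:E.
  rewrite -ge0_integralD//.
  rewrite -[leLHS]mule1 -(probability_setT zeta) -integral_cst//.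
  apply: ge0_le_integral => //.
  - by move=> x _; rewrite lee_fin ltW.
  - exact: emeasurable_funD.
have I2 : \int[sigma]_x leb (xsection B2 x) <= \int[sigma]_x (Num.max x 0)%:E.
  exact: ge0_le_integral.
have I12 : t%:E * \int[zeta]_x leb (xsection B1 x) <= \int[sigma]_x leb (xsection B2 x).
  rewrite integral_sections// integral_sections//.
  rewrite -ge0_integralZl_EFin//; last exact: ltW.
  apply: ge0_le_integral => //.
  - by move=> x _; rewrite mule_ge0// lee_fin ltW.
  - exact: measurable_funeM.
  - by move=> z _; exact: le12.
move: lt_tk; apply/negP; rewrite -leNgt.
have t0' : 0 <= t%:E by rewrite lee_fin ltW.
rewrite EFinM; apply: (le_trans (lee_wpmul2l t0' I1)).
rewrite ge0_muleDr ?integral_ge0// addeC leeD2l//.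
exact: le_trans I2.
Qed.

End threshold.

(** * The law of a sum of independent variables *)

Section sum_law.
Local Open Scope ereal_scope.
Context d (T : measurableType d) (R : realType) (P : probability T R) (l : nat)
  (X : 'I_l -> {RV P >-> R}) (mu : probability R R)
  (X_prod : forall (J : {set 'I_l}) (A : 'I_l -> set R),
    (forall i, measurable (A i)) ->
    P [set t | forall i, i \in J -> A i (X i t)] = \prod_(i in J) mu (A i)).

Let partial_sum n (t : T) : R := (\sum_(i < l | (i < n)%N) X i t)%R.

Let measurable_partial_sum n : measurable_fun [set: T] (partial_sum n).
Proof.
have msum (s : seq 'I_l) :
    measurable_fun [set: T] (fun t => \sum_(i <- s | (i < n)%N) X i t)%R.
  elim: s => [|i s IH].
    by apply: (eq_measurable_fun (cst (0%R : R))) => // t _; rewrite big_nil.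
  have [ni|ni] := boolP (i < n)%N; last first.
    by apply: eq_measurable_fun IH => t _; rewrite big_cons (negbTE ni).
  apply: (eq_measurable_fun (X i \+ fun t => \sum_(j <- s | (j < n)%N) X j t)%R).
    by move=> t _; rewrite big_cons ni.
  exact: measurable_funD.
exact: msum.
Qed.

Let tail_event n (A : 'I_l -> set R) : set T :=
  [set t | forall i : 'I_l, (n <= i)%N -> A i (X i t)].

Let measurable_tail_event n A : (forall i, measurable (A i)) ->
  measurable (tail_event n A).
Proof.
move=> mA; rewrite (_ : tail_event n A =
  \bigcap_(i in [set i : 'I_l | (n <= i)%N]) (X i @^-1` A i)); last first.
  by apply/seteqP; split => t h i /= ni; exact: h.
apply: fin_bigcap_measurable; first exact: finite_finset.
move=> i _; have := @measurable_funP _ _ _ _ setT (X i) measurableT _ (mA i).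
by rewrite setTI.
Qed.

Let tail_prod n (A : 'I_l -> set R) : R :=
  (\prod_(i < l | (n <= i)%N) fine (mu (A i)))%R.

(** Adding variables one at a time requires the partial sum to be independent of those not yet
    added, so the induction carries the tail event along. At [n = 0] this is the product rule; at
    [n = l] the tail event is trivial. *)
Lemma partial_sum_law n C A : (n <= l)%N -> measurable C ->
  (forall i, measurable (A i)) ->
  P ((partial_sum n @^-1` C) `&` tail_event n A) =
  convn mu n C * (tail_prod n A)%:E.
Proof.
elim: n C A => [|n IH] C A nl mC mA.
  have S0 t : partial_sum 0 t = 0%R by rewrite /partial_sum big_pred0.
  have -> : partial_sum 0 @^-1` C = if 0%R \in C then setT else set0.
    apply/seteqP; split => t; rewrite /= S0; case: ifPn => //.
    + by move=> /negP h Ct; apply: h; rewrite inE.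
    + by rewrite inE.
  rewrite /= diracE; case: ifPn => [_|_]; last by rewrite set0I measure0 mul0e.
  rewrite setTI mul1e (_ : tail_event 0 A =
    [set t | forall i, i \in [set: 'I_l]%SET -> A i (X i t)]); last first.
    by apply/seteqP; split => t h i _; apply: h; rewrite ?inE.
  rewrite X_prod// -prodEFin; apply: eq_big => [i|i _]; first by rewrite inE.
  by rewrite fineK// fin_num_measure.
pose o := Ordinal nl.
pose E := tail_event n.+1 A.
have mE : measurable E by exact: measurable_tail_event.
pose phi (t : T) : R * R := (X o t, partial_sum n t).
have mphi : measurable_fun [set: T] phi by exact: measurable_fun_pair.
(* With [B] placed at index [n] of the family, the condition on [X o] joins the tail event and the
   induction hypothesis applies to rectangles. *)
have IH' B D : measurable B -> measurable D ->
    P (((X o @^-1` B) `&` (partial_sum n @^-1` D)) `&` E) =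
    (mu B * convn mu n D) * (tail_prod n.+1 A)%:E.
  move=> mB mD; pose A' i := if i == o then B else A i.
  have mA' i : measurable (A' i) by rewrite /A'; case: ifP.
  have := IH D A' (ltnW nl) mD mA'.
  have -> : tail_prod n A' = (fine (mu B) * tail_prod n.+1 A)%R.
    rewrite /tail_prod (bigD1 o)//= {1}/A' eqxx; congr (_ * _)%R.
    apply: eq_big => [i|i /andP[_ /negbTE io]]; last by rewrite /A' io.
    by rewrite ltn_neqAle andbC eq_sym.
  rewrite EFinM fineK ?fin_num_measure// muleA => IHB; rewrite (muleC (mu B)) -IHB.
  congr (P _); apply/seteqP; split => t.
  - move=> [[Bt Dt] Et]; split => // i; rewrite leq_eqVlt => /predU1P[ni|ni].
      by rewrite /A' (_ : i = o) ?eqxx//; exact/val_inj.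
    rewrite /A' ifN; first exact: Et.
    by apply/negP => /eqP io; move: ni; rewrite io ltnn.
  - move=> [Dt Et]; split; first split => //.
      by have := Et o (leqnn n); rewrite /A' eqxx.
    move=> i ni; have := Et i (ltnW ni); rewrite /A' ifN//.
    by apply/negP => /eqP io; move: ni; rewrite io ltnn.
have sumS t : partial_sum n.+1 t = pair_sum (phi t).
  rewrite /partial_sum /pair_sum /= (bigD1 o)//=; congr (_ + _)%R.
  by apply: eq_bigl => i; rewrite ltnS ltn_neqAle andbC.
set c := tail_prod n.+1 A in IH' *.
have c0 : (0 <= c)%R by apply: prodr_ge0 => i _; exact: fine_ge0.
have [M ME] : exists M : {measure set (R * R) -> \bar R},
    forall D, M D = P ((phi @^-1` D) `&` E).
  by unshelve eexists (Measure.clone _ _ _ (pushforward (mrestr P mE) phi) _).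
pose D := pair_sum @^-1` C.
have mD : measurable D by rewrite -[D]setTI; exact: measurable_pair_sum.
have -> : partial_sum n.+1 @^-1` C `&` E = phi @^-1` D `&` E.
  by congr (_ `&` _); apply/seteqP; split => t; rewrite /D /= sumS.
rewrite -ME (_ : convn mu n.+1 C = (mu \x convn mu n) D)//.
(* Uniqueness of the product measure is applied to [M] divided by [c]; when [c = 0] the total mass
   of [M] vanishes instead. *)
have [c_eq0|c_neq0] := eqVneq c 0%R.
  have MD : M D <= (mu setT * convn mu n setT) * c%:E.
    rewrite -IH'// ME !preimage_setT !setTI le_measure ?inE//.
    by apply: measurableI => //; rewrite -[phi @^-1` _]setTI; exact: mphi.
  by apply/eqP; move: MD; rewrite c_eq0 !mule0 measure_le0.
have ci0 : (0 <= c^-1)%R by rewrite invr_ge0.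
have := @product_measure_unique _ _ _ _ R mu (convn mu n)
  (mscale (NngNum ci0) M) _ D mD.
move=> ->; last first.
  move=> B F mB mF; apply: (etrans (congr1 (fun x => c^-1%:E * x) (ME _))) => /=.
  rewrite [X in P X](_ : _ =
    ((X o @^-1` B) `&` (partial_sum n @^-1` F)) `&` E); last by [].
  by rewrite IH'// muleCA -EFinM mulVf// mule1.
rewrite /mscale/= muleAC -EFinM mulVf// mul1e//.
Qed.

Lemma sum_law C : measurable C ->
  P [set t | C (\sum_(i < l) X i t)%R] = convn mu l C.
Proof.
move=> mC; have := @partial_sum_law l C (fun=> setT) (leqnn l) mC (fun=> measurableT).
rewrite /tail_prod big_pred0 ?mule1; last by move=> i; rewrite leqNgt ltn_ord.
move=> <-; congr (P _); apply/seteqP; split => t; rewrite /partial_sum /=.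
- move=> Ct; split; last by move=> i; rewrite leqNgt ltn_ord.
  by rewrite (eq_bigl xpredT)// => i; rewrite ltn_ord.
- by move=> [+ _]; rewrite (eq_bigl xpredT)// => i; rewrite ltn_ord.
Qed.

End sum_law.

(** * Mean and tail estimates for convolutions *)

Section tail_inequalities.
Local Open Scope ereal_scope.
Context {R : realType}.
Implicit Types (mu zeta ups sigma : probability R R) (k c : R).

Let pos0 (x : R) : 0 <= (Num.max x 0)%:E.
Proof. by rewrite lee_fin le_max lexx orbT. Qed.

Let mpos : measurable_fun [set: R] (fun x : R => (Num.max x 0)%:E).
Proof. by apply/measurable_EFinP; exact: measurable_maxr. Qed.

Lemma prob_itvNyo mu k :
  mu `]-oo, k[%classic = 1 - mu `[k, +oo[%classic.
Proof.
rewrite -probability_setC; last exact: measurable_itv.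
by rewrite setCitvr.
Qed.

Lemma expectation_convn_le ups n :
  \int[convn ups n.+1]_x (Num.max x 0)%:E <=
  n.+1%:R%:E * \int[ups]_x (Num.max x 0)%:E.
Proof.
have := @integral_convn_pos _ ups n (cst 1) (measurable_cst 1) (fun=> lee01).
have c1 (x : R) : \int[convn ups n]_y cst 1 (x + y)%R = 1.
  by rewrite integral_cst// mul1e; exact: probability_setT.
under eq_integral do rewrite mule1.
by under [X in _ <= _ * X -> _]eq_integral do rewrite c1 mule1.
Qed.

(** Markov's inequality combined with exchangeability: when the whole sum is at least [k] and one
    summand is at most [c], the other [n] reach [k - c]. *)
Lemma tail_convn_le ups n k c : (0 < k)%R -> ups `]c, +oo[%classic = 0 ->
  k%:E * convn ups n.+1 `[k, +oo[%classic <=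
  n.+1%:R%:E * (\int[ups]_x (Num.max x 0)%:E * convn ups n `[(k - c)%R, +oo[%classic).
Proof.
move=> k0 upsc.
pose h (x : R) : \bar R := (\1_(`[k, +oo[%classic : set R) x)%:E.
have mh : measurable_fun [set: R] h.
  by apply/measurable_EFinP/measurable_indic; exact: measurable_itv.
have h0 x : 0 <= h x by rewrite lee_fin.
apply: le_trans (le_trans (integral_convn_pos ups n mh h0) _).
  rewrite -(setIT `[k, +oo[%classic) -integral_indic//.
  rewrite -ge0_integralZl_EFin//; last exact: ltW.
  apply: ge0_le_integral => //.
  - by move=> x _; rewrite mule_ge0// lee_fin ltW.
  - exact: measurable_funeM.
  - exact: emeasurable_funM.
  move=> x _; rewrite /h indicE; case: (boolP (x \in _)) => [|_].
    by rewrite inE /= in_itv/= andbT => kx; rewrite !mule1 lee_fin le_max kx.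
  by rewrite !mule0.
rewrite lee_wpmul2l//.
have q0 : 0 <= convn ups n `[(k - c)%R, +oo[%classic by [].
rewrite -ge0_integralZr//.
have mI : measurable_fun [set: R] (fun x => \int[convn ups n]_y h (x + y)%R).
  exact: measurable_integral_shift.
apply: ae_ge0_le_integral => //.
- by move=> x _; rewrite mule_ge0// integral_ge0.
- exact: emeasurable_funM.
- by move=> x _; rewrite mule_ge0.
- by apply: emeasurable_funM => //; exact: measurable_cst.
(* The comparison holds for [x <= c], and [ups] does not charge the points above [c]. *)
exists `]c, +oo[%classic; split => //.
move=> x /= xc; rewrite in_itv/= andbT ltNge; apply/negP => cx; apply: xc => _.
rewrite lee_wpmul2l//.
rewrite -(setIT `[(k - c)%R, +oo[%classic) -integral_indic//.
apply: ge0_le_integral => //.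
- exact: (measurable_shift x mh).
- by apply/measurable_EFinP/measurable_indic; exact: measurable_itv.
move=> y _; rewrite /h lee_fin !indicE ler_nat.
case: (boolP ((x + y)%R \in _)) => //; rewrite inE /= in_itv/= andbT => xy.
rewrite mem_set//= in_itv/= andbT.
by rewrite lerBlDr (le_trans xy)// addrC lerD2l.
Qed.

(** [Z <= z] and [S < k - z] are independent events that together force [Z + S < k]. *)
Lemma conv_lower zeta sigma k (z : R) :
  zeta `]-oo, z]%classic * (1 - sigma `[(k - z)%R, +oo[%classic) <=
  conv zeta sigma `]-oo, k[%classic.
Proof.
rewrite -prob_itvNyo -product_measure1E; [|exact: measurable_itv..].
apply: le_measure; rewrite ?inE.
- by apply: measurableX; exact: measurable_itv.
- by rewrite -[_ @^-1` _]setTI; apply: measurable_pair_sum => //; exact: measurable_itv.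
move=> [x y] /= []; rewrite !in_itv/= /pair_sum/= => xz yz.
by rewrite -(subrK z k) addrC ltr_leD.
Qed.
End tail_inequalities.

(** * The tail bound for [p > 1/k] *)

Section tail_bound.
Context {R : realType}.
Implicit Types (mu zeta ups : probability R R) (p k c : R).
Local Open Scope ereal_scope.

Lemma fine_prob d (T : measurableType d) (mu : probability T R) (A : set T) :
  measurable A -> exists2 x : R, mu A = x%:E & (0 <= x <= 1)%R.
Proof.
move=> mA; exists (fine (mu A)); first by rewrite fineK// fin_num_measure.
by rewrite fine_ge0//= -lee_fin fineK ?fin_num_measure// probability_le1.
Qed.

(** Here [l = m.+2]. With [t = (l - 1) p / (1 - p)], the hypothesis on [(m.+2 + m.+1) p] amounts to
    [t >= 1/2], and the last factor of the bound is [(1 - p) (2 t - 1)]. *)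
Lemma convn_tail_bound mu zeta ups p k c m :
  (0 < p < 1)%R -> (1 < p * k)%R -> (1 <= (m.+2 + m.+1)%:R * p)%R ->
  mixture p zeta ups mu -> \int[mu]_x (Num.max x 0)%:E <= 1 ->
  zeta `]-oo, c[%classic = 0 -> ups `]c, +oo[%classic = 0 ->
  convn mu m.+2 `[k, +oo[%classic <=
  (1 - ((1 - p) ^+ m.+2 -
     m.+2%:R * p * (1 - p) ^+ m * (2 * m.+1%:R * p - (1 - p))))%:E.
Proof.
move=> /[dup] p01 /andP[p0 p1] pk lp mix mean1 zc uc.
have q0 : (0 < 1 - p)%R by rewrite subr_gt0.
have k0 : (0 < k)%R by rewrite -(pmulr_rgt0 _ p0) (lt_trans _ pk).
have mh (x : R) : measurable (`[x, +oo[%classic : set R) by exact: measurable_itv.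
have ml (x : R) : measurable (`]-oo, x[%classic : set R) by exact: measurable_itv.
have mlc (x : R) : measurable (`]-oo, x]%classic : set R) by exact: measurable_itv.
(* Both weights are positive, so the bound on the mean of the mixture makes both component means
   finite. *)
have [ez [ey [EZ EY ez0 [ey0 eyz]]]] : exists ez ey : R,
    [/\ \int[zeta]_x (Num.max x 0)%:E = ez%:E, \int[ups]_x (Num.max x 0)%:E = ey%:E,
        (0 <= ez)%R & (0 <= ey)%R /\ (p * ez + (1 - p) * ey <= 1)%R].
  have p01' : (0 <= p <= 1)%R by rewrite !ltW.
  move: mean1; rewrite (integral_mixture p01' mix); last 2 first.
  - by apply/measurable_EFinP; exact: measurable_maxr.
  - by move=> x; rewrite lee_fin le_max lexx orbT.
  have : 0 <= \int[zeta]_x (Num.max x 0)%:E.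
    by apply: integral_ge0 => x _; rewrite lee_fin le_max lexx orbT.
  have : 0 <= \int[ups]_x (Num.max x 0)%:E.
    by apply: integral_ge0 => x _; rewrite lee_fin le_max lexx orbT.
  case: (\int[zeta]_x _) => [ez| |]; case: (\int[ups]_x _) => [ey| |] //=.
  - by rewrite !lee_fin => ey0 ez0 h; exists ez, ey.
  - by rewrite gt0_muley ?lte_fin// addey.
  - by rewrite gt0_muley ?lte_fin// addye.
  - by rewrite !gt0_muley ?lte_fin// addye.
pose sigma := convn ups m.+1.
pose t : R := (m.+1%:R * p / (1 - p))%R.
have t0 : (0 < t)%R by rewrite divr_gt0// mulr_gt0.
have tq : (t * (1 - p) = m.+1%:R * p)%R by rewrite /t divfK// gt_eqF.
have t2 : (1 <= 2 * t)%R.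
  rewrite -(ler_pM2r q0) mul1r -mulrA tq.
  by move: lp; rewrite natrD -[m.+2%:R]natr1; lra.
have [z [z0 zk]] : exists z : R, [/\ (0 < z)%R, (z < k)%R &
    sigma `[(k - z)%R, +oo[%classic < t%:E * zeta `]-oo, z]%classic].
  apply: threshold_exists => //; rewrite EZ.
  have := expectation_convn_le ups m; rewrite EY -EFinM => Es.
  apply: le_lt_trans (leeD2l _ Es) _.
  (* After multiplication by [p], the identity [(l - 1) p = t (1 - p)] reduces the claim to
     [t (p ez + (1 - p) ey) < t p k]. *)
  rewrite -EFinM -EFinD lte_fin -(ltr_pM2r p0).
  have : (m.+1%:R * ey * p = t * ((1 - p) * ey))%R.
    by rewrite mulrA tq; ring.
  have : (t * (p * ez + (1 - p) * ey) < t * (p * k))%R.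
    by rewrite ltr_pM2l//; exact: le_lt_trans eyz pk.
  by lra.
(* Notation: [w = Pr[Z <= z]], [s = Pr[S >= k - z]], [p' = Pr[S >= k - c]], [r = Pr[S_l >= k]], [q =
   Pr[Z + S < k]]; [a] is the probability to bound. *)
have [w zw /andP[w0 w1]] := fine_prob zeta (mlc z).
have [s ss /andP[s0 s1]] := fine_prob sigma (mh (k - z)%R).
have [p' sp' /andP[p'0 _]] := fine_prob sigma (mh (k - c)%R).
have [r ur /andP[r0 r1]] := fine_prob (convn ups m.+2) (mh k).
have [q zq /andP[qge0 _]] := fine_prob (conv zeta sigma) (ml k).
have [a ma /andP[a0 a1]] := fine_prob (convn mu m.+2) (mh k).
rewrite ma ss zw -EFinM !lte_fin lee_fin => sw.
(* If [z < c] then [w = 0], and [s < t w] would make [s] negative. *)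
have cz : (c <= z)%R.
  rewrite leNgt; apply/negP => zc'.
  have : zeta `]-oo, z]%classic <= zeta `]-oo, c[%classic.
    apply: le_measure; rewrite ?inE// => x /=; rewrite !in_itv/= => xz.
    exact: le_lt_trans zc'.
  rewrite zw zc lee_fin => w0'.
  by move: sw; apply/negP; rewrite -leNgt (le_trans _ s0)// mulr_ge0_le0// ltW.
have p's : (p' <= s)%R.
  rewrite -lee_fin -sp' -ss; apply: le_measure; rewrite ?inE// => x /=.
  by rewrite !in_itv/= !andbT; apply: le_trans; rewrite lerD2l lerN2.
have qlow : (w * (1 - s) <= q)%R.
  have := conv_lower zeta sigma k z; rewrite zw zq.
  by rewrite ss -EFinB -EFinM lee_fin.
have rup : (k * r <= m.+2%:R * (ey * p'))%R.
  have := tail_convn_le m.+1 k0 uc; rewrite ur EY.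
  by rewrite sp' -!EFinM lee_fin.
have ale : ((1 - p) ^+ m.+2 * (1 - r) + m.+2%:R * p * (1 - p) ^+ m.+1 * q <= 1 - a)%R.
  pose f (x : R) : \bar R := (\1_(`]-oo, k[%classic : set R) x)%:E.
  have mf : measurable_fun [set: R] f.
    by apply/measurable_EFinP/measurable_indic.
  have f0 x : 0 <= f x by rewrite lee_fin.
  have p01' : (0 <= p <= 1)%R by rewrite !ltW.
  have := convn_mixture_ge m.+1 p01' mix mf f0.
  have fE (nu : probability R R) : \int[nu]_x f x = nu `]-oo, k[%classic.
    by rewrite integral_indic// setIT.
  have UE : \int[convn ups m.+2]_x f x = 1 - r%:E.
    by apply: etrans (fE _) _; rewrite -ur; exact: prob_itvNyo.
  have ZE : \int[conv zeta (convn ups m.+1)]_x f x = q%:E.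
    by apply: etrans (fE _) _.
  have ME : \int[convn mu m.+2]_x f x = 1 - a%:E.
    by apply: etrans (fE _) _; rewrite -ma; exact: prob_itvNyo.
  by rewrite UE ZE ME -!EFinB -!EFinM -EFinD lee_fin.
(* In the Markov bound, [p k > 1] removes [k] and [(1 - p) ey <= 1] removes the mean. *)
have rup' : ((1 - p) * r <= m.+2%:R * p * p')%R.
  have h1 : (r <= p * k * r)%R by rewrite ler_peMl// ltW.
  have h2 : (p * (k * r) <= p * (m.+2%:R * (ey * p')))%R by rewrite ler_pM2l.
  have h3 : ((1 - p) * ey * p' <= p')%R.
    by rewrite ler_piMl// (le_trans _ eyz)// lerDr mulr_ge0// ltW.
  have h4 : (m.+2%:R * p * ((1 - p) * ey * p') <= m.+2%:R * p * p')%R.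
    by rewrite ler_wpM2l// mulr_ge0// ltW.
  have h5 : ((1 - p) * r <= (1 - p) * (p * (m.+2%:R * (ey * p'))))%R.
    by rewrite ler_pM2l//; lra.
  by lra.
(* The left side is at most [(1 + w) t w - w], which falls short of [2 t - 1] by
   [(1 - w) (t (w + 2) - 1) >= 0]. *)
have diff : (p' - q <= 2 * t - 1)%R.
  have h1 : ((1 + w) * s <= (1 + w) * (t * w))%R.
    by rewrite ler_wpM2l ?addr_ge0// ltW.
  have h2 : (0 <= (1 - w) * (t * (w + 2) - 1))%R.
    by rewrite mulr_ge0 ?subr_ge0// mulrDr; nra.
  by lra.
have K0 : (0 <= m.+2%:R * p * (1 - p) ^+ m.+1)%R.
  by rewrite mulr_ge0 ?exprn_ge0 ?mulr_ge0// ltW.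
have e0 : (0 <= (1 - p) ^+ m.+1)%R by rewrite exprn_ge0// ltW.
(* With [K = l p (1 - p)^(l-1)], the loss due to [r] is at most [K p'] and the gain is [K q], so
   only [p' - q] matters. *)
have f1 := ler_wpM2l e0 rup'.
have f2 := ler_wpM2l K0 diff.
have f3 : (m.+2%:R * p * (1 - p) ^+ m.+1 * (2 * t - 1) =
  m.+2%:R * p * (1 - p) ^+ m * (2 * m.+1%:R * p - (1 - p)))%R.
  by rewrite exprSr -[(2 * m.+1%:R * p)%R]mulrA -tq; ring.
rewrite -f3; move: ale; rewrite [((1 - p) ^+ m.+2)%R]exprSr => ale.
by lra.
Qed.

End tail_bound.

(** * Passage to the limit as [p] decreases to [1/k] *)

Lemma cvg_at_right_ge (R : realType) (f : R -> R) (a x : R) :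
  {for x, continuous f} -> (\forall y \near x^'+, a <= f y) -> a <= f x.
Proof. by move=> cf; apply: cvgr_to_ge; exact: cvg_at_right_filter. Qed.

Theorem corollary1p15 (R : realType) (dsp : measure_display)
    (T : measurableType dsp) (P : probability T R)
    (l d : nat) (X : 'I_l -> {RV P >-> R})
    (X_indep : mutually_independent X)
    (X_ident : identically_distributed X)
    (X_ge0 : forall i t, 0 <= X i t)
    (X_mean : forall i, ('E_P[X i] = 1)%E)
    (d_ge1 : (1 <= d)%N)
    (d_lt_l : (d < l)%N) :
  (P [set t | (\sum_(i < l) X i t >= (l + d)%:R)%R] <= (g R (l + d) d)%:E)%E.
Proof.
(* Since [1 <= d < l], there are at least two variables: [l = m.+2]. *)
case: l X X_indep X_ident X_ge0 X_mean d_lt_l => [//|[|m]] X X_indep X_ident X_ge0 X_mean d_lt_l.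
  by case: d d_ge1 d_lt_l.
pose mu : probability R R := distribution P (X ord0).
pose k : R := (m.+2 + d)%:R.
have k0 : 0 < k by rewrite ltr0n.
have k1 : 1 < k by rewrite ltr1n.
have mI : measurable (`[k, +oo[%classic : set R) by exact: measurable_itv.
have -> : P [set t | (\sum_(i < m.+2) X i t >= (m.+2 + d)%:R)%R] =
    convn mu m.+2 `[k, +oo[%classic.
  rewrite -(sum_law (X := X) (mu := mu))//.
    by congr (P _); apply/seteqP; split => t; rewrite /= in_itv/= andbT.
  move=> J A mA; rewrite X_indep//; apply: eq_bigr => i _.
  exact: X_ident.
have mean1 : (\int[mu]_x (Num.max x 0)%:E <= 1)%E.
  rewrite /mu ge0_integral_distribution//; last 2 first.
  - by apply/measurable_EFinP; exact: measurable_maxr.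
  - by move=> x; rewrite lee_fin le_max lexx orbT.
  rewrite -(X_mean ord0) expectation_def le_eqVlt; apply/orP; left; apply/eqP.
  by apply: eq_integral => t _ /=; rewrite max_l.
have [a aE _] := fine_prob (convn mu m.+2) mI.
rewrite aE lee_fin.
pose F (p : R) := 1 - ((1 - p) ^+ m.+2 -
     m.+2%:R * p * (1 - p) ^+ m * (2 * m.+1%:R * p - (1 - p))).
have -> : g R (m.+2 + d) d = F k^-1.
  rewrite /g /F addnK div1r -/k; congr (1 - _).
  have kE : k = m.+2%:R + d%:R :> R by rewrite /k natrD.
  have mE : m.+2%:R = m.+1%:R + 1 :> R by rewrite natr1.
  have k10 : k - 1 != 0 by rewrite subr_eq0 gt_eqF.
  have x0 : 1 - k^-1 = (k - 1) / k by rewrite mulrBl divff ?gt_eqF// mul1r.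
  have e2 (x : R) : x ^+ m.+2 = x ^+ m * x ^+ 2 by rewrite -addn2 exprD.
  (* Setting the common power aside and eliminating [d] leaves a rational identity. *)
  rewrite !e2; set e := _ ^+ m.
  rewrite x0 (_ : d%:R = k - m.+1%:R - 1); last by rewrite kE mE; ring.
  rewrite mE; field.
  have -> : 2 + m%:R + d%:R = k :> R by rewrite kE -natrD.
  by rewrite k10 gt_eqF.
apply: cvg_at_right_ge.
  pose Q : {poly R} := 1 - ((1 - 'X) ^+ m.+2 -
    m.+2%:R *: 'X * (1 - 'X) ^+ m * ((2 * m.+1%:R) *: 'X - (1 - 'X))).
  rewrite (_ : F = horner Q); first exact: continuous_horner.
  by apply/funext => p; rewrite /F /Q !hornerE.
near=> p.
have pk : k^-1 < p by near: p; exact: nbhs_right_gt.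
have p1 : p < 1 by near: p; apply: nbhs_right_lt; rewrite invf_lt1.
have p0 : 0 < p by rewrite (lt_trans _ pk)// invr_gt0.
have p01 : 0 < p < 1 by rewrite p0.
have pk1 : 1 < p * k by rewrite -ltr_pdivrMr// mul1r.
have [c [hc lc]] := quantile_exists (X ord0) p01.
have [zeta [ups [mix zc uc]]] := mixture_split (mu := mu) p01 hc lc.
rewrite -lee_fin -aE; apply: (convn_tail_bound p01 pk1 _ mix mean1 zc uc).
(* From [d < l] follows [k = l + d <= 2 l - 1], hence [(2 l - 1) p >= p k > 1]. *)
rewrite mulrC (le_trans (ltW pk1))// ler_pM2l// ler_nat addSnnS addnC.
by rewrite leq_add2r.
Unshelve. all: by end_near.
Qed.
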